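(* Let $a<b<c$ be positive integers with $\gcd(a,b,c)=1$, and let $C_{a,b,c}\subset\mathbb{P}^3$ be the monomial curve, i.e. the closure of the set of points with homogeneous coordinates $(1:t^a:t^b:t^c)$, $t\in\mathbb{C}$. Then $C_{a,b,c}$ is osculating self-dual. Moreover, $C_{a,b,c}$ is Legendrian with respect to an appropriate contact structure on $\mathbb{P}^3$ if and only if the sequence of exponents $(0,a,b,c)$ is symmetric, i.e. $(0,a,b,c)=(0,c-b,c-a,c)$.
   Context: The base field is $\mathbb{C}$. Points of $\mathbb{P}(E)$ are lines in the vector space $E$. Contact structure on $\mathbb{P}^3$: let $\mathbb{P}^3=\mathbb{P}(E)$, $\dim E=4$, and let $B$ be a non-degenerate skew-symmetric bilinear form on $E$. The contact structure on $\mathbb{P}(E)$ corresponding to $B$ assigns to each point $x=(v)$, $v\in E\setminus\{0\}$, the contact hyperplane $\mathcal{S}_x=\mathcal{T}_x\mathbb{P}(v^\perp)\subset\mathcal{T}_x\mathbb{P}(E)$, where $v^\perp$ is the skew-orthogonal complement of $v$ with respect to $B$. ''A contact structure on $\mathbb{P}^3$'' means the one corresponding to some such $B$. A curve $C\subset\mathbb{P}^3$ is Legendrian with respect to the contact structure if $\mathcal{T}_yC\subset\mathcal{S}_y$ for each smooth point $y\in C$. For a projective curve $C\subset\mathbb{P}^3$ not contained in a plane and a general point $x\in C$, there is a unique plane $\operatorname{Osc}^2_xC$ osculating to $C$ at $x$ to order $2$, i.e. containing $x$ and such that the restriction of its local equation to $C$ lies in $\mathfrak{m}_x^3$, where $\mathfrak{m}_x\subset\mathcal{O}_{x,C}$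 is the maximal ideal. The osculating dual $C^\vee\subset(\mathbb{P}^3)^*$ is the closure of the set of points corresponding to the planes $\operatorname{Osc}^2_xC$ for general $x\in C$. The curve $C$ is called osculating self-dual if there is a projective (linear) isomorphism $\mathbb{P}^3\to(\mathbb{P}^3)^*$ mapping $C$ onto $C^\vee$. *)

(* Defs.v *)
From HB Require Import structures.
From mathcomp Require Import all_boot all_order all_algebra.
From mathcomp Require Import classical_sets.
From mathcomp Require Import mpoly.

Set Implicit Arguments.
Unset Strict Implicit.
Unset Printing Implicit Defensive.

Import GRing.Theory.
Local Open Scope ring_scope.
Local Open Scope classical_set_scope.

Section ProjectiveSpace.
Variables (F : fieldType) (n : nat).

Definition proj := {U : {vspace 'rV[F]_n.+1} | \dim U == 1%N}.

Implicit Types (x y : proj) (p q : {mpoly F[n.+1]}) (A C Z U : set proj).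

(* Homogeneous coordinates of x, and the value of p at them. For homogeneous
   p, neither the vanishing of [hval p x] nor the quotient [hval p x / hval q x]
   (q of the same degree) depends on the choice of coordinates. *)
Definition rep x : 'rV[F]_n.+1 := vpick (val x).
Definition hval p x : F := p.@[rep x 0].

Definition homogeneous p : Prop := exists d : nat, p \is d.-homog.

Definition zlocus (G : set {mpoly F[n.+1]}) : set proj :=
  [set x | forall p, G p -> hval p x = 0].

Definition zclosed Z : Prop :=
  exists2 G : set {mpoly F[n.+1]}, G `<=` homogeneous & Z = zlocus G.

Definition zclosure A : set proj := smallest zclosed A.

Definition zopen_in C U : Prop := exists2 Z, zclosed Z & U = C `\` Z.

Definition dense_open_in C U : Prop := zopen_in C U /\ C `<=` zclosure U.

(* [P] holds on a Zariski neighbourhood of x in C. *)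
Definition zariski_near C x (P : proj -> Prop) : Prop :=
  exists U, [/\ zopen_in C U, U x & U `<=` P].

(* Elements of the local ring O_{x,C} of the reduced variety C are germs at x
   of functions on C. They are represented here by arbitrary functions on the
   projective space, of which only the restriction to a neighbourhood of x in C
   is relevant. *)
Definition regular_at C x (f : proj -> F) : Prop :=
  exists (d : nat) p q,
    [/\ p \is d.-homog, q \is d.-homog, hval q x != 0 &
        zariski_near C x (fun y => f y = hval p y / hval q y)].

Definition in_max_ideal C x (f : proj -> F) : Prop :=
  regular_at C x f /\ f x = 0.

(* The germ of f belongs to the k-th power of the maximal ideal of O_{x,C}. *)
Definition in_max_ideal_pow C x (k : nat) (f : proj -> F) : Prop :=
  exists (m : nat) (h : 'I_m -> proj -> F) (g : 'I_m -> 'I_k -> proj -> F),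
    [/\ forall i, regular_at C x (h i),
        forall i j, in_max_ideal C x (g i j) &
        zariski_near C x (fun y => f y = \sum_i h i y * \prod_j g i j y)].

Definition linform (w : 'rV[F]_n.+1) : {mpoly F[n.+1]} :=
  \sum_i w 0 i *: 'X_i.

(* The affine cone over the embedded tangent space of Z at x (where Z x holds):
   since T_x P(E) = Hom(x, E / x), the Zariski tangent space of Z at x is
   Hom(x, tangent_cone Z x / x). Thus inclusions of tangent spaces at x are
   inclusions of these cones, and the dimension of the cone is one more than
   that of the tangent space. *)
Definition tangent_cone Z x : set 'rV[F]_n.+1 :=
  [set u : 'rV[F]_n.+1 | forall p, homogeneous p ->
     (forall y, Z y -> hval p y = 0) ->
     \sum_i u 0 i * (p^`M(i)).@[rep x 0] = 0].

(* The Zariski tangent space of the curve C at x is one-dimensional. *)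
Definition smooth_point C x : Prop :=
  C x /\ exists2 T : {vspace 'rV[F]_n.+1},
    tangent_cone C x = [set u | u \in T] & \dim T = 2%N.

End ProjectiveSpace.

Section SpaceCurves.
Variable F : fieldType.
Implicit Types (x y : proj F 3) (w : proj F 3) (C D U : set (proj F 3)).

(* The dual of 'rV_4 is identified with 'rV_4 through the dual basis: the point
   w of the dual space is the plane with equation [linform (rep w)]. Dividing
   this equation by a linear form l which does not vanish at x gives a local
   equation of the plane at x. *)
Definition osculating_plane C x w : Prop :=
  hval (linform (rep w)) x = 0 /\
  forall l : 'rV[F]_4, hval (linform l) x != 0 ->
    in_max_ideal_pow C x 3
      (fun y => hval (linform (rep w)) y / hval (linform l) y).

(* D is the osculating dual of C; "for general x in C" means for x in any
   sufficiently small dense open subset of C. *)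
Definition osculating_dual C D : Prop :=
  exists U0, [/\ dense_open_in C U0,
    forall x, U0 x -> exists! w, osculating_plane C x w &
    forall U, dense_open_in C U -> U `<=` U0 ->
      D = zclosure [set w | exists2 x, U x & osculating_plane C x w]].

Definition osculating_self_dual C : Prop :=
  exists2 D, osculating_dual C D &
  exists2 f : 'End('rV[F]_4), lker f == 0%VS &
    D = [set w | exists2 x, C x & val w = (f @: val x)%VS].

(* The projectivization of the skew-orthogonal complement of x. *)
Definition polar_plane (B : {skew_symmetric 'rV[F]_4}) x : set (proj F 3) :=
  [set y : proj F 3 | forall u v, u \in val x -> v \in val y -> B u v = 0].

Definition contact_hyperplane (B : {skew_symmetric 'rV[F]_4}) x :
    set 'rV[F]_4 :=
  tangent_cone (polar_plane B x) x.

Definition legendrian (B : {skew_symmetric 'rV[F]_4}) C : Prop :=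
  forall y, smooth_point C y -> tangent_cone C y `<=` contact_hyperplane B y.

Definition monomial_point (a b c : nat) (t : F) : 'rV[F]_4 :=
  \row_(i < 4) t ^+ nth 0%N [:: 0; a; b; c]%N i.

Definition monomial_curve (a b c : nat) : set (proj F 3) :=
  zclosure [set x | exists t : F, val x = <[monomial_point a b c t]>%VS].

End SpaceCurves.

Arguments monomial_curve F a b c : clear implicits.

(* Main.v *)
(* Write e = (0, a, b, c), so that the curve is parametrized by
   gamma(t) = (t^e_i). Since gcd(a, b, c) = 1, a Bezout relation recovers t from
   the torus point gamma(t) as a quotient of monomials, so that orders of
   vanishing in the local rings of the curve at torus points are orders of
   vanishing of polynomials in t. The osculating plane w at gamma(t) is thus
   characterized by (X - t)^3 | sum_i w_i X^e_i, that is, (w_i t^e_i) spans the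
   kernel of the 3 x 4 Vandermonde matrix (e_i^k). Hence w = d gamma(1/t) for the
   constant diagonal matrix d of signed Vandermonde minors, and the osculating
   dual is the image of the curve under d.

   The tangent line at gamma(t) is spanned by gamma(t) and (e_i t^e_i). If the
   curve is Legendrian for B, then sum_(i < j) B_ij (e_j - e_i) t^(e_i + e_j) = 0;
   when c != a + b the six exponents e_i + e_j are distinct, so that B = 0. When
   c = a + b, the form (b - a)(u0 v3 - u3 v0) - c (u1 v2 - u2 v1) works; at the two
   points of the curve outside of the torus, the tangent space is controlled by
   the quadric X0 X3 = X1 X2. *)

Require Import Defs.
From mathcomp Require Import all_boot all_order all_algebra.
From mathcomp Require Import boolp classical_sets reals complex.
From mathcomp Require Import mpoly ring zify.

Set Implicit Arguments.
Unset Strict Implicit.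
Unset Printing Implicit Defensive.

Import Order.TTheory GRing.Theory Num.Theory.
Local Open Scope ring_scope.

(** * Homogeneous coordinates, Zariski closures and diagonal changes of coordinates *)

Section Points.
Variables (F : fieldType) (n : nat).
Implicit Types (x y : proj F n) (p q : {mpoly F[n.+1]}) (u v : 'rV[F]_n.+1).

Lemma dim_line v : v != 0 -> \dim <[v]>%VS == 1%N.
Proof. by rewrite dim_vline => ->. Qed.

Definition line v (nz_v : v != 0) : proj F n := exist _ <[v]>%VS (dim_line nz_v).

Lemma rep_neq0 x : rep x != 0.
Proof. by rewrite vpick0 -dimv_eq0 (eqP (valP x)). Qed.

Lemma val_rep x : val x = <[rep x]>%VS.
Proof.
apply/esym/eqP; rewrite eqEdim -memvE memv_pick /=.
by rewrite (eqP (valP x)) dim_vline rep_neq0.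
Qed.

Lemma rep_line x v : val x = <[v]>%VS -> exists2 k, k != 0 & rep x = k *: v.
Proof.
move=> hx; have : rep x \in <[v]>%VS by rewrite -hx memv_pick.
case/vlineP=> k hk; exists k => //; apply: contraNneq (rep_neq0 x) => k0.
by rewrite hk k0 scale0r.
Qed.

Lemma vline_scale k v : k != 0 -> <[k *: v]>%VS = <[v]>%VS.
Proof.
move=> nz_k; apply/eqP; rewrite eqEsubv -!memvE memvZ ?memv_line //=.
by rewrite -{1}[v](scalerK nz_k) memvZ ?memv_line.
Qed.

Lemma homogZ d p k v :
  p \is d.-homog -> p.@[(k *: v) 0] = k ^+ d * p.@[v 0].
Proof.
move=> /dhomogP hp; rewrite !mevalE mulr_sumr big_seq [RHS]big_seq.
apply: eq_bigr => m /hp <-; rewrite mulrCA; congr (_ * _).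
rewrite /= mdegE -prodrXr -big_split /=.
by apply: eq_bigr => i _; rewrite mxE exprMn.
Qed.

Lemma dhomog_homogeneous d p : p \is d.-homog -> homogeneous p.
Proof. by exists d. Qed.

Lemma hval_eq0 p x v : homogeneous p -> val x = <[v]>%VS ->
  (hval p x == 0) = (p.@[v 0] == 0).
Proof.
move=> [d hp] /rep_line[k nz_k hk].
by rewrite /hval hk (homogZ _ _ hp) mulf_eq0 expf_eq0 (negPf nz_k) andbF.
Qed.

Lemma hval_eq0P p x v : homogeneous p -> val x = <[v]>%VS ->
  hval p x = 0 <-> p.@[v 0] = 0.
Proof.
by move=> hp hx; split=> /eqP h; apply/eqP; move: h; rewrite (hval_eq0 hp hx).
Qed.

Lemma hval_line p v (nz_v : v != 0) : homogeneous p ->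
  hval p (line nz_v) = 0 <-> p.@[v 0] = 0.
Proof. by move=> hp; apply: hval_eq0P. Qed.

Lemma hval_ratio d p q x v : p \is d.-homog -> q \is d.-homog ->
  val x = <[v]>%VS -> hval p x / hval q x = p.@[v 0] / q.@[v 0].
Proof.
move=> hp hq /rep_line[k nz_k hk].
by rewrite /hval hk (homogZ _ _ hp) (homogZ _ _ hq) -mulf_div divff
  ?mul1r // expf_neq0.
Qed.

(** The forms vanishing on [A] cut out a closed set containing [A], and every closed set containing
    [A] is cut out by some of these forms. *)
Lemma zclosureP (A : set (proj F n)) x : zclosure A x <->
  (forall p, homogeneous p -> (forall y, A y -> hval p y = 0) -> hval p x = 0).
Proof.
split=> [clx p hp pA | px Z [[G hG ->] AZ] p Gp].
  apply: (clx (zlocus [set q | homogeneous q /\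
    forall y, A y -> hval q y = 0]%classic)) => //.
  split; last by move=> y Ay q [_]; apply.
  by eexists; last reflexivity; move=> q [].
by apply: px => [|y Ay]; [apply: hG | apply: AZ].
Qed.

Lemma zclosed_hval_eq0 p : homogeneous p ->
  zclosed [set x | hval p x = 0]%classic.
Proof.
move=> hp; exists [set p]%classic; first by move=> _ ->.
by apply/seteqP; split=> [x px _ ->|x]; last exact.
Qed.

Lemma dhomogX1 i : ('X_i : {mpoly F[n.+1]}) \is 1.-homog.
Proof. by rewrite dhomogX /= mdeg1. Qed.

Lemma dhomogXn i k : ('X_i ^+ k : {mpoly F[n.+1]}) \is k.-homog.
Proof. by rewrite -[k in k.-homog]mul1n; apply/dhomogMn/dhomogX1. Qed.

Lemma dhomog_linform u : linform u \is 1.-homog.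
Proof. by apply: rpred_sum => i _; apply/rpredZ/dhomogX1. Qed.

Lemma meval_linform u v : (linform u).@[v 0] = \sum_i u 0 i * v 0 i.
Proof.
by rewrite raddf_sum /=; apply: eq_bigr => i _; rewrite mevalZ mevalXU.
Qed.

(* Composition with the endomorphism [mulmxr (diag_mx d)]. *)
Definition mscale (d : 'rV[F]_n.+1) p : {mpoly F[n.+1]} :=
  p \mPo [tuple d 0 i *: 'X_i | i < n.+1].

Lemma meval_mscale d p v : (mscale d p).@[v 0] = p.@[(v *m diag_mx d) 0].
Proof.
rewrite comp_mpoly_meval; apply: meval_eq => i.
by rewrite tnth_mktuple mevalZ mevalXU mul_mx_diag mxE mulrC.
Qed.

Lemma homog_mscale d p : homogeneous p -> homogeneous (mscale d p).
Proof.
case=> k /dhomogP hp; exists k; rewrite /mscale comp_mpolyE big_seq.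
apply: rpred_sum => m /hp <-; apply: rpredZ; rewrite /= mdegE.
elim/big_rec2: _ => [|i q l _ hq]; first exact: dhomog1.
apply: dhomogM => //; rewrite tnth_mktuple exprZn.
exact/rpredZ/dhomogXn.
Qed.

End Points.

(** * Restriction of polynomials to polynomial arcs *)

Section ChainRule.
Variables (R : comNzRingType) (n : nat).
Implicit Types (p q : {mpoly R[n]}) (f : 'I_n -> {poly R}).

Definition subst f p : {poly R} := mmap polyC f p.


Lemma substD f p q : subst f (p + q) = subst f p + subst f q.
Proof. exact: rmorphD. Qed.

Lemma substB f p q : subst f (p - q) = subst f p - subst f q.
Proof. exact: rmorphB. Qed.

Lemma substM f p q : subst f (p * q) = subst f p * subst f q.
Proof. exact: rmorphM. Qed.

Lemma substXn f p k : subst f (p ^+ k) = subst f p ^+ k.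
Proof. exact: rmorphXn. Qed.

Lemma substZ f r p : subst f (r *: p) = r *: subst f p.
Proof. by rewrite /subst mmapZ mul_polyC. Qed.

Lemma substX f i : subst f 'X_i = f i.
Proof. by rewrite /subst mmapX mmap1U. Qed.

Lemma substE f p t : (subst f p).[t] = p.@[fun i => (f i).[t]].
Proof.
rewrite /subst /meval /mmap horner_sum; apply: eq_bigr => m _.
rewrite hornerCM; congr (_ * _); rewrite /mmap1 horner_prod.
by apply: eq_bigr => i _; rewrite horner_exp.
Qed.

(** Both sides are linear in [p], which leaves monomials; there the degree drops by splitting off
    one variable and applying the product rule. *)
Lemma deriv_subst f p :
  (subst f p)^`() = \sum_i (f i)^`() * subst f p^`M(i).
Proof.
have add q r : (subst f q)^`() = \sum_i (f i)^`() * subst f q^`M(i) ->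
    (subst f r)^`() = \sum_i (f i)^`() * subst f r^`M(i) ->
    (subst f (q + r))^`() = \sum_i (f i)^`() * subst f (q + r)^`M(i).
  move=> hq hr; rewrite substD derivD hq hr -big_split.
  by apply: eq_bigr => i _; rewrite mderivD substD mulrDr.
elim/mpolyind: p => [|r m p _ _ hp].
  rewrite [subst f 0]rmorph0 deriv0 big1 // => i _.
  by rewrite mderiv0 [subst f 0]rmorph0 mulr0.
apply: add => //; rewrite substZ derivZ.
under eq_bigr do rewrite mderivZ substZ -scalerAr.
rewrite -scaler_sumr; congr (_ *: _); move: {p hp} (mdeg m) {-2}m (erefl (mdeg m)).
elim=> [|k IHk] {}m mk.
  move/eqP: mk; rewrite mdeg_eq0 => /eqP->; rewrite mpolyX0 [subst f 1]rmorph1.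
  rewrite -[1]/(1%:P) derivC big1 // => i _.
  by rewrite -mpolyC1 mderivC [subst f 0]rmorph0 mulr0.
have /existsP[j mj] : [exists j, m j != 0%N].
  apply: contraPT mk; rewrite negb_exists => /forallP m0.
  by rewrite mdegE big1 // => i _; apply/eqP/negPn.
have le_jm : (U_(j) <= m)%MM by rewrite lep1mP.
have mE : m = (m - U_(j) + U_(j))%MM by rewrite submK.
have mk' : mdeg (m - U_(j)) = k by move: mk; rewrite {1}mE mdegD mdeg1; lia.
rewrite mE mpolyXD substM derivM (IHk _ mk') substX.
under [RHS]eq_bigr do rewrite mderivM substD !substM substX mulrDr mulrA.
rewrite big_split -mulr_suml /=; congr (_ + _).
rewrite (bigD1 j) //= big1 => [|i ne_ij]; rewrite mderivX mnm1E.
  have -> : (U_(j) - U_(j))%MM = 0%MM.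
    by apply/mnmP => i; rewrite mnmBE mnm0E subnn.
  by rewrite eqxx mpolyX0 scale1r [subst f 1]rmorph1 addr0 mulr1 mulrC.
by rewrite eq_sym (negPf ne_ij) scale0r [subst f 0]rmorph0 !mulr0.
Qed.

End ChainRule.

Lemma subst_linform (F : fieldType) n (f : 'I_n.+1 -> {poly F}) (u : 'rV[F]_n.+1) :
  subst f (linform u) = \sum_i u 0 i *: f i.
Proof.
rewrite /subst raddf_sum; apply: eq_bigr => i _.
by rewrite /= [LHS]substZ substX.
Qed.

(** * Univariate polynomials in characteristic zero *)

Section Polynomials.
Variable F : numFieldType.
Implicit Types (p q : {poly F}) (t : F).

Lemma natr_neq0 n : (0 < n)%N -> n%:R != 0 :> F.
Proof. by rewrite pnatr_eq0 -lt0n. Qed.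

Lemma natrB_neq0 m n : (m < n)%N -> n%:R - m%:R != 0 :> F.
Proof. by move=> lt_mn; rewrite -natrB ?natr_neq0 ?subn_gt0 // ltnW. Qed.

(** In characteristic zero the first [size p] natural numbers are distinct, and a nonzero [p] has
    fewer roots than that. *)
Lemma poly_eq0 p : (forall t, p.[t] = 0) -> p = 0.
Proof.
move=> p0; apply: (@roots_geq_poly_eq0 _ p [seq k%:R | k <- iota 0 (size p)]).
- by apply/allP => t _; rewrite rootE p0.
- by rewrite map_inj_uniq ?iota_uniq //; apply: mulrIn; rewrite oner_eq0.
- by rewrite size_map size_iota.
Qed.

(* The complement of a finite set of points of the line is represented by a
   nonzero polynomial which vanishes on the finite set. *)
Lemma poly_eq0_cofinite q p :
  q != 0 -> (forall t, q.[t] != 0 -> p.[t] = 0) -> p = 0.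
Proof.
move=> nz_q p0; have /eqP : p * q = 0.
  apply: poly_eq0 => t; rewrite hornerM.
  by have [->|/p0->] := eqVneq q.[t] 0; rewrite ?mulr0 ?mul0r.
by rewrite mulf_eq0 (negPf nz_q) orbF => /eqP.
Qed.

(** Factors X - t are split off one at a time; the last one comes from the second derivative, whose
    value at [t] is twice that of the remaining cofactor, and 2 is invertible. *)
Lemma dvdp_XsubC_cubeP p t : reflect
  [/\ p.[t] = 0, p^`().[t] = 0 & p^`()^`().[t] = 0]
  (('X - t%:P) ^+ 3 %| p).
Proof.
apply: (iffP idP) => [/dvdpP[q ->] | [p0 p1 p2]].
  rewrite !derivE !exprS expr0.
  by split; rewrite !hornerE /= subrr; ring.
have /factor_theorem[q qE] : root p t by apply/eqP.
have q0 : root q t.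
  by move: p1; rewrite qE !derivE !hornerE subrr mulr0 add0r => /eqP.
have /factor_theorem[r rE] := q0.
have r0 : root r t.
  have : 2%:R * r.[t] = 0.
    rewrite -p2 qE rE !derivE !hornerE /= subrr. ring.
  by move=> /eqP; rewrite mulf_eq0 pnatr_eq0.
have /factor_theorem[s sE] := r0.
by apply/dvdpP; exists s; rewrite qE rE sE; ring.
Qed.

Lemma sum_monomials_eq0 (I : finType) (n : I -> nat) (r : I -> F) :
  injective n -> \sum_i r i *: 'X^(n i) = 0 :> {poly F} -> forall i, r i = 0.
Proof.
move=> n_inj /(congr1 (fun p : {poly F} => p`_(n _))) + i => /(_ i).
rewrite coef0 coef_sum (bigD1 i) //= coefZ coefXn eqxx mulr1 big1 ?addr0 //.
by move=> j ne_ji; rewrite coefZ coefXn eq_sym (inj_eq n_inj) (negPf ne_ji) mulr0.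
Qed.

End Polynomials.

Definition o0 : 'I_4 := @Ordinal 4 0 isT.
Definition o1 : 'I_4 := @Ordinal 4 1 isT.
Definition o2 : 'I_4 := @Ordinal 4 2 isT.
Definition o3 : 'I_4 := @Ordinal 4 3 isT.

Lemma sum_ord4 (V : nmodType) (f : 'I_4 -> V) :
  \sum_i f i = f o0 + f o1 + f o2 + f o3.
Proof.
rewrite !big_ord_recl big_ord0 addr0 !addrA.
by congr (_ + _ + _ + _); apply: (congr1 f); apply: val_inj.
Qed.

Lemma forall_ord4 (P : 'I_4 -> Prop) : P o0 -> P o1 -> P o2 -> P o3 -> forall i, P i.
Proof.
move=> P0 P1 P2 P3 [[|[|[|[|//]]]] lti].
- by rewrite (_ : Ordinal lti = o0) //; apply: val_inj.
- by rewrite (_ : Ordinal lti = o1) //; apply: val_inj.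
- by rewrite (_ : Ordinal lti = o2) //; apply: val_inj.
- by rewrite (_ : Ordinal lti = o3) //; apply: val_inj.
Qed.

(** * The monomial curve, its ideal and its points outside of the torus *)

Section MonomialCurve.
Variables (F : numFieldType) (a b c : nat).
Hypotheses (ha : (0 < a)%N) (hab : (a < b)%N) (hbc : (b < c)%N).
Implicit Types (t : F) (x y : proj F 3) (p q : {mpoly F[4]}) (u v w : 'rV[F]_4).

Definition expo (i : 'I_4) := nth 0%N [:: 0; a; b; c]%N i.
Local Notation gam := (@monomial_point F a b c).
Local Notation C := (monomial_curve F a b c).
Definition pull := @subst F 4 (fun i => 'X^(expo i)).

Lemma gamE t i : gam t 0 i = t ^+ expo i.
Proof. by rewrite mxE. Qed.

Lemma gam_neq0 t : gam t != 0.
Proof.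
apply/eqP => /rowP/(_ o0); rewrite gamE mxE expr0 => /eqP.
by rewrite oner_eq0.
Qed.

Definition pt t : proj F 3 := line (gam_neq0 t).

Lemma val_pt t : val (pt t) = <[gam t]>%VS.
Proof. by []. Qed.

Lemma pullE p t : (pull p).[t] = p.@[gam t 0].
Proof.
by rewrite substE; apply: meval_eq => i; rewrite gamE hornerXn.
Qed.

Lemma hval_pt p t : homogeneous p -> hval p (pt t) = 0 <-> (pull p).[t] = 0.
Proof. by move=> hp; rewrite pullE; apply: hval_eq0P. Qed.

(** Over an infinite field a form vanishes at all gamma(t) exactly when its restriction is the zero
    polynomial, so the forms in the kernel of [pull] generate the homogeneous ideal of the curve. *)
Lemma curveP x :
  C x <-> (forall p, homogeneous p -> pull p = 0 -> hval p x = 0).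
Proof.
split=> [/zclosureP Cx p hp p0 | Cx].
  by apply: Cx => // y [t /(hval_eq0P hp)->]; rewrite -pullE p0 horner0.
apply/zclosureP => p hp p0; apply: Cx => //; apply: poly_eq0 => t.
by apply/hval_pt => //; apply: p0; exists t.
Qed.

Lemma curve_pt t : C (pt t).
Proof. by apply/curveP => p hp p0; apply/hval_pt; rewrite // p0 horner0. Qed.

(** The identity (t^e_i)^e_j = (t^e_j)^e_i, homogenized by ['X_o0]; for [i <= j] the truncated
    subtraction is exact. *)
Definition toric_binomial (i j : 'I_4) : {mpoly F[4]} :=
  'X_i ^+ expo j - 'X_j ^+ expo i * 'X_o0 ^+ (expo j - expo i).

Lemma expo_mono (i j : 'I_4) : (i <= j)%N -> (expo i <= expo j)%N.
Proof.
elim/forall_ord4: i; elim/forall_ord4: j; rewrite /expo //=; lia.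
Qed.

Lemma homog_toric_binomial (i j : 'I_4) : (i <= j)%N -> toric_binomial i j \is (expo j).-homog.
Proof.
move=> /expo_mono le_ij; rewrite rpredB ?dhomogXn //.
by rewrite -{2}(subnKC le_ij); apply: dhomogM; apply: dhomogXn.
Qed.

Lemma pull_toric_binomial i j : pull (toric_binomial i j) = 0.
Proof.
rewrite /pull substB substM !substXn !substX [expo o0]/= expr0.
by rewrite expr1n mulr1 -!exprM mulnC subrr.
Qed.

Lemma curve_binomial y (i j : 'I_4) : (i <= j)%N -> C y ->
  rep y 0 i ^+ expo j = rep y 0 j ^+ expo i * rep y 0 o0 ^+ (expo j - expo i).
Proof.
move=> le_ij /curveP Cy; have := Cy (toric_binomial i j).
move=> /(_ (dhomog_homogeneous (homog_toric_binomial le_ij)) (pull_toric_binomial i j)).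
rewrite /hval /toric_binomial rmorphB rmorphM !rmorphXn /= !mevalXU => /eqP.
by rewrite subr_eq0 => /eqP.
Qed.

(** The toric binomials propagate zeros among the coordinates: off the torus only the limits t = 0
    and t = infinity remain. *)
Lemma curve_cases y : C y ->
  [\/ forall i, rep y 0 i != 0,
      [/\ rep y 0 o0 != 0, rep y 0 o1 = 0, rep y 0 o2 = 0 & rep y 0 o3 = 0] |
      [/\ rep y 0 o0 = 0, rep y 0 o1 = 0, rep y 0 o2 = 0 & rep y 0 o3 != 0]].
Proof.
move=> Cy; have B i j le_ij := @curve_binomial y i j le_ij Cy.
have := rep_neq0 y; move: (rep y) B => v B nz_v.
have B12 := B o1 o2 isT; have B13 := B o1 o3 isT; have B23 := B o2 o3 isT.
rewrite /expo /= {B} in B12 B13 B23.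
have [v0|nz0] := eqVneq (v 0 o0) 0.
  have v1 : v 0 o1 = 0.
    move/eqP: B12; rewrite v0 expr0n.
    have -> : (b - a == 0)%N = false by lia.
    by rewrite mulr0 expf_eq0 => /andP[_ /eqP].
  have v2 : v 0 o2 = 0.
    move/eqP: B23; rewrite v0 expr0n.
    have -> : (c - b == 0)%N = false by lia.
    by rewrite mulr0 expf_eq0 => /andP[_ /eqP].
  apply: Or33; split=> //; apply: contraNneq nz_v => v3.
  by apply/eqP/rowP; apply: forall_ord4; rewrite mxE.
have [v1|nz1] := eqVneq (v 0 o1) 0.
  apply: Or32; split=> //.
    move/esym/eqP: B12; rewrite v1 expr0n.
    have -> : (b == 0)%N = false by lia.
    by rewrite mulf_eq0 !expf_eq0 (negPf nz0) andbF orbF => /andP[_ /eqP].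
  move/esym/eqP: B13; rewrite v1 expr0n.
  have -> : (c == 0)%N = false by lia.
  by rewrite mulf_eq0 !expf_eq0 (negPf nz0) andbF orbF => /andP[_ /eqP].
apply: Or31; apply: forall_ord4 => //.
  apply: contraNneq nz1 => v2; move/eqP: B12; rewrite v2 expr0n.
  by rewrite gtn_eqF // mul0r expf_eq0 => /andP[_ /eqP->].
apply: contraNneq nz1 => v3; move/eqP: B13; rewrite v3 expr0n.
by rewrite gtn_eqF // mul0r expf_eq0 => /andP[_ /eqP->].
Qed.

End MonomialCurve.

Arguments hval_pt {F a b c p t}.
Arguments val_pt {F a b c}.
Arguments pullE {F a b c}.
Arguments gamE {F a b c}.
Arguments curveP {F a b c x}.
Arguments curve_pt {F a b c} t.

(** The extended Euclidean algorithm is applied to [a] with [gcdn b c], then to [b] with [c]; the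
    terms are placed so that all coefficients are natural numbers. *)
Lemma bezout_nat a b c : (0 < a)%N -> (0 < b)%N -> gcdn a (gcdn b c) = 1%N ->
  exists al be ch, (al * a + ch * c = be * b + 1)%N.
Proof.
move=> a0 b0 g1; case: (egcdnP (gcdn b c) a0); rewrite g1 => k k' kE _.
case: (egcdnP c b0) => kb kc gE _; exists k, (k' * kb)%N, (k' * kc)%N.
nia.
Qed.

(** * Recovering the parameter on the torus, and regular functions of it *)

Section TorusPart.
Variables (F : numFieldType) (a b c al be ch : nat).
Hypotheses (ha : (0 < a)%N) (hab : (a < b)%N) (hbc : (b < c)%N).
Hypothesis bez : (al * a + ch * c = be * b + 1)%N.
Implicit Types (t s : F) (x y : proj F 3) (p q : {mpoly F[4]}) (u v w : 'rV[F]_4).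

Local Notation e := (expo a b c).
Local Notation gam := (@monomial_point F a b c).
Local Notation C := (monomial_curve F a b c).
Local Notation pull := (@pull F a b c).
Local Notation pt := (@pt F a b c).

(** Raising to [e i] turns each factor into a power of [r i]; by [bez] the total exponent al a + ch
    c - be b is 1. *)
Lemma parameter_exp (r : 'I_4 -> F) :
  (forall i, r i != 0) -> (forall i j, r i ^+ e j = r j ^+ e i) ->
  forall i, (r o1 ^+ al * r o3 ^+ ch / r o2 ^+ be) ^+ e i = r i.
Proof.
move=> r_neq0 rX i.
rewrite !exprMn exprVn -!exprM ![(_ * e i)%N]mulnC !exprM.
rewrite (rX o1 i : _ = _ ^+ a) (rX o3 i : _ = _ ^+ c) (rX o2 i : _ = _ ^+ b).
rewrite -!exprM -exprD [(a * _)%N]mulnC [(c * _)%N]mulnC bez.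
by rewrite addn1 exprSr mulnC mulrAC divff ?mul1r // expf_neq0.
Qed.

Lemma torus_pt y : C y -> (forall i, rep y 0 i != 0) ->
  exists2 t, t != 0 & y = pt t.
Proof.
(* Normalized by X_0 = 1, the toric binomials become the symmetric relations r_i^e_j = r_j^e_i. *)
move=> Cy nz_y; pose r i := rep y 0 i / rep y 0 o0.
have r_neq0 i : r i != 0 by rewrite mulf_neq0 ?invr_eq0.
have rX_le (i j : 'I_4) : (i <= j)%N -> r i ^+ e j = r j ^+ e i.
  move=> le_ij; rewrite !exprMn (curve_binomial ha hab hbc le_ij Cy) !exprVn.
  have le_e : (e i <= e j)%N by apply: expo_mono.
  rewrite -{2}(subnKC le_e) exprD invfM; field.
  by rewrite !expf_neq0.
have rX i j : r i ^+ e j = r j ^+ e i.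
  by case/orP: (leq_total i j) => /rX_le.
pose t := r o1 ^+ al * r o3 ^+ ch / r o2 ^+ be.
have tX := parameter_exp r_neq0 rX.
exists t; first by rewrite !mulf_neq0 ?invr_eq0 ?expf_neq0.
apply: val_inj; rewrite val_pt val_rep -(vline_scale (gam t) (nz_y o0)).
congr (<[_]>)%VS; apply/rowP => i; rewrite [RHS]mxE gamE tX.
by rewrite mulrC divfK.
Qed.

(** The Laurent monomial X_1^al X_3^ch / X_2^be, with powers of X_0 giving numerator and denominator
    the same degree. *)
Definition tau_num : {mpoly F[4]} := 'X_o1 ^+ al * 'X_o3 ^+ ch * 'X_o0 ^+ be.
Definition tau_den : {mpoly F[4]} := 'X_o2 ^+ be * 'X_o0 ^+ (al + ch).

Lemma homog_tau_num : tau_num \is (al + ch + be).-homog.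
Proof. by rewrite !dhomogM ?dhomogXn. Qed.

Lemma homog_tau_den : tau_den \is (al + ch + be).-homog.
Proof. by rewrite addnC dhomogM ?dhomogXn. Qed.

Lemma tau_den_gam t : tau_den.@[gam t 0] = t ^+ (b * be).
Proof.
by rewrite rmorphM !rmorphXn /= !mevalXU !gamE /= expr0 expr1n mulr1 -exprM.
Qed.

Lemma tau_num_gam t : tau_num.@[gam t 0] = t * t ^+ (b * be).
Proof.
rewrite !rmorphM !rmorphXn /= !mevalXU !gamE /= expr0 expr1n mulr1 -!exprM.
by rewrite -exprD -exprS; congr (_ ^+ _); rewrite /expo /=; lia.
Qed.

Definition tau y := hval tau_num y / hval tau_den y.

Lemma tau_pt t : t != 0 -> tau (pt t) = t.
Proof.
move=> nz_t; rewrite /tau (hval_ratio homog_tau_num homog_tau_den (val_pt _)).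
by rewrite tau_num_gam tau_den_gam mulfK // expf_neq0.
Qed.

Definition torus_eq : {mpoly F[4]} := 'X_o0 * 'X_o1 * 'X_o2 * 'X_o3.

Lemma homog_torus_eq : homogeneous torus_eq.
Proof.
exists (1 + 1 + 1 + 1)%N.
do 3?[apply: dhomogM; last exact: dhomogX1].
exact: dhomogX1.
Qed.

Lemma hval_torus_eq y : (hval torus_eq y != 0) = [forall i, rep y 0 i != 0].
Proof.
rewrite /hval !rmorphM /= !mevalXU !mulf_eq0 !negb_or.
apply/idP/forallP => [/andP[/andP[/andP[? ?] ?] ?] | nz_y].
  exact: forall_ord4.
by rewrite !nz_y.
Qed.

Definition torus_part : set (proj F 3) :=
  (C `\` [set y | hval torus_eq y = 0])%classic.

Lemma torus_partP y : torus_part y <-> exists2 t, t != 0 & y = pt t.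
Proof.
split=> [[Cy /eqP]|[t nz_t ->]].
  by rewrite hval_torus_eq => /forallP; apply: torus_pt.
split; first exact: curve_pt.
move=> /(hval_pt homog_torus_eq) /eqP; apply/negP.
rewrite pullE !rmorphM /= !mevalXU !gamE.
by rewrite !mulf_neq0 ?expf_neq0.
Qed.

Lemma zopen_torus_part : zopen_in C torus_part.
Proof. by eexists; first exact: (zclosed_hval_eq0 homog_torus_eq). Qed.

Lemma near_torus t (P : proj F 3 -> Prop) :
  t != 0 -> (forall s, s != 0 -> P (pt s)) -> zariski_near C (pt t) P.
Proof.
move=> nz_t Ppt; exists torus_part; split; first exact: zopen_torus_part.
  by apply/torus_partP; exists t.
by move=> y /torus_partP[s nz_s ->]; apply: Ppt.
Qed.

(** Some form defining the removed closed set is nonzero at [y]; wherever it is nonzero along gamma,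
    the point stays in [U]. *)
Lemma zopen_pull (U : set (proj F 3)) y : zopen_in C U -> U y ->
  exists p, [/\ homogeneous p, hval p y <> 0 &
    forall s, (pull p).[s] != 0 -> U (pt s)].
Proof.
move=> [_ [G Ghom ->] ->] [_ /existsNP[p /not_implyP[Gp py]]].
have hp := Ghom _ Gp; exists p; split=> // s /eqP ps0.
by split; [exact: curve_pt | move=> /(_ p Gp)/(hval_pt hp)].
Qed.

Lemma near_cofinite t (P : proj F 3 -> Prop) : zariski_near C (pt t) P ->
  exists2 N : {poly F}, N.[t] != 0 & forall s, N.[s] != 0 -> P (pt s).
Proof.
move=> [U [oU Ut UP]]; have [p [hp pt0 pU]] := zopen_pull oU Ut.
exists (pull p); first by apply/eqP => p0; apply/pt0/hval_pt.
by move=> s /pU/UP.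
Qed.

(* The polynomial P(tau), homogenized in degree m (for size P <= m + 1) *)
Definition htau m (P : {poly F}) : {mpoly F[4]} :=
  \sum_(k < m.+1) P`_k *: (tau_num ^+ k * tau_den ^+ (m - k)).

Lemma homog_htau m (P : {poly F}) : htau m P \is ((al + ch + be) * m).-homog.
Proof.
apply: rpred_sum => k _; apply: rpredZ.
have le_km : (k <= m)%N by rewrite -ltnS.
rewrite (_ : _ * m = (al + ch + be) * k + (al + ch + be) * (m - k))%N.
  by apply: dhomogM; apply: dhomogMn; [apply: homog_tau_num | apply: homog_tau_den].
by rewrite -mulnDr subnKC.
Qed.

Lemma htau_gam m (P : {poly F}) t : (size P <= m.+1)%N ->
  (htau m P).@[gam t 0] = t ^+ (b * be) ^+ m * P.[t].
Proof.
move=> le_Pm; rewrite (horner_coef_wide _ le_Pm) mulr_sumr raddf_sum /=.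
apply: eq_bigr => k _; rewrite mevalZ rmorphM !rmorphXn /= tau_num_gam tau_den_gam.
have le_km : (k <= m)%N by rewrite -ltnS.
set N := t ^+ (b * be).
rewrite (_ : N ^+ m = N ^+ k * N ^+ (m - k)); first by rewrite exprMn; ring.
by rewrite -exprD subnKC.
Qed.

Lemma regular_at_pt t (f : proj F 3 -> F) (P Q : {poly F}) :
  t != 0 -> Q.[t] != 0 -> (forall s, s != 0 -> f (pt s) = P.[s] / Q.[s]) ->
  regular_at C (pt t) f.
Proof.
(* A common [m] gives both homogenizations the same degree and lets the powers of [tau_den] cancel
   in the quotient. *)
move=> nz_t nz_Qt fE; set m := maxn (size P) (size Q).
have leP : (size P <= m.+1)%N by rewrite leqW // leq_maxl.
have leQ : (size Q <= m.+1)%N by rewrite leqW // leq_maxr.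
exists ((al + ch + be) * m)%N, (htau m P), (htau m Q).
split; try exact: homog_htau.
  rewrite (hval_eq0 (dhomog_homogeneous (homog_htau _ _)) (val_pt _)).
  by rewrite htau_gam // mulf_neq0 ?expf_neq0.
apply: near_torus => // s nz_s.
rewrite (hval_ratio (homog_htau _ _) (homog_htau _ _) (val_pt _)).
by rewrite !htau_gam // fE // -mulf_div divff ?mul1r // !expf_neq0.
Qed.

End TorusPart.

(** * Orders of vanishing along the parametrization *)

Section OrderOfVanishing.
Variables (F : numFieldType) (a b c : nat).
Implicit Types (t s : F) (f g : proj F 3 -> F).
Local Notation C := (monomial_curve F a b c).
Local Notation pull := (@pull F a b c).
Local Notation pt := (@pt F a b c).

(* Along the parametrization, the order of vanishing of f at t is at least k *)
Definition order_geq t k f := exists2 D : {poly F}, D.[t] != 0 &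
  exists E : {poly F}, forall s, D.[s] != 0 ->
    f (pt s) * D.[s] = (('X - t%:P) ^+ k * E).[s].

Lemma order_geq_regular t f : regular_at C (pt t) f -> order_geq t 0 f.
Proof.
move=> [d [p [q [hp hq qt fE]]]].
have [N Nt NfE] := near_cofinite fE.
(* The factor [N] discards the parameters at which the fraction [p / q] is not known to represent
   [f]. *)
exists (pull q * N).
  rewrite hornerM mulf_neq0 //; apply: contraNneq qt => /hval_pt.
  by move=> /(_ (dhomog_homogeneous hq)) ->.
exists (pull p * N) => s; rewrite hornerM mulf_eq0 negb_or => /andP[qs Ns].
rewrite NfE // (hval_ratio hp hq (val_pt _)) mul1r hornerM -!pullE.
by rewrite mulrA divfK.
Qed.

Lemma order_geq_max_ideal t f : in_max_ideal C (pt t) f -> order_geq t 1 f.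
Proof.
move=> [/order_geq_regular[D Dt [E fE]] ft]; exists D => //.
have /factor_theorem[E' EE'] : root E t.
  by apply/eqP; have := fE t Dt; rewrite ft mul0r expr0 mul1r.
by exists E' => s /fE->; rewrite EE' expr0 mul1r expr1 mulrC.
Qed.

Lemma order_geqD t k f g :
  order_geq t k f -> order_geq t k g -> order_geq t k (fun y => f y + g y).
Proof.
move=> [D Dt [E fE]] [D' Dt' [E' gE]]; exists (D * D').
  by rewrite hornerM mulf_neq0.
exists (E * D' + E' * D) => s; rewrite hornerM mulf_eq0 negb_or => /andP[/fE + /gE].
rewrite !hornerM !hornerD !hornerM => fs gs.
by rewrite mulrDl mulrA fs [D.[s] * _]mulrC mulrA gs; ring.
Qed.

Lemma order_geqM t k l f g :
  order_geq t k f -> order_geq t l g -> order_geq t (k + l) (fun y => f y * g y).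
Proof.
move=> [D Dt [E fE]] [D' Dt' [E' gE]]; exists (D * D').
  by rewrite hornerM mulf_neq0.
exists (E * E') => s; rewrite hornerM mulf_eq0 negb_or => /andP[/fE + /gE].
rewrite exprD !hornerM => fs gs.
by rewrite mulrACA fs gs; ring.
Qed.

Lemma order_geq_const t r : order_geq t 0 (fun=> r).
Proof.
exists 1; first by rewrite hornerC oner_eq0.
by exists r%:P => s _; rewrite !hornerE.
Qed.

Lemma order_geq0 t k : order_geq t k (fun=> 0).
Proof.
exists 1; first by rewrite hornerC oner_eq0.
by exists 0 => s _; rewrite !hornerE.
Qed.

Lemma order_geq_prod t k (g : 'I_k -> proj F 3 -> F) :
  (forall j, order_geq t 1 (g j)) -> order_geq t k (fun y => \prod_j g j y).
Proof.
elim: k g => [|k IHk] g hg.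
  rewrite (_ : (fun _ => _) = fun=> 1); first exact: order_geq_const.
  by apply/funext => y; rewrite big_ord0.
rewrite (_ : (fun _ => _) = fun y => g ord0 y * \prod_j g (lift ord0 j) y).
  by apply: (@order_geqM t 1 k) => //; apply: IHk.
by apply/funext => y; rewrite big_ord_recl.
Qed.

Lemma order_geq_sum t k m (f : 'I_m -> proj F 3 -> F) :
  (forall i, order_geq t k (f i)) -> order_geq t k (fun y => \sum_i f i y).
Proof.
elim: m f => [|m IHm] f hf.
  rewrite (_ : (fun _ => _) = fun=> 0); first exact: order_geq0.
  by apply/funext => y; rewrite big_ord0.
rewrite (_ : (fun _ => _) = fun y => f ord0 y + \sum_i f (lift ord0 i) y).
  by apply: order_geqD => //; apply: IHm.
by apply/funext => y; rewrite big_ord_recl.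
Qed.

(** Orders add in products and persist in sums; regular functions have order at least 0, elements of
    the maximal ideal order at least 1. *)
Lemma order_geq_max_ideal_pow t k f :
  in_max_ideal_pow C (pt t) k f -> order_geq t k f.
Proof.
move=> [m [h [g [hh hg fE]]]]; have [N Nt NfE] := near_cofinite fE.
have [i|D Dt [E sE]] := @order_geq_sum t k m (fun i y => h i y * \prod_j g i j y).
  apply: (@order_geqM t 0 k); first exact: order_geq_regular.
  by apply: order_geq_prod => j; apply: order_geq_max_ideal.
exists (D * N); first by rewrite hornerM mulf_neq0.
exists (E * N) => s; rewrite hornerM mulf_eq0 negb_or => /andP[Ds Ns].
by rewrite !hornerM !mulrA NfE // sE // hornerM.
Qed.

End OrderOfVanishing.

(** * Osculating planes and the dual curve *)

Section SelfDuality.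
Variables (F : numFieldType) (a b c : nat).
Hypotheses (ha : (0 < a)%N) (hab : (a < b)%N) (hbc : (b < c)%N).
Hypothesis hgcd : gcdn a (gcdn b c) = 1%N.
Implicit Types (t s : F) (x y : proj F 3) (p q : {mpoly F[4]}) (u v : 'rV[F]_4).
Implicit Types (w : proj F 3).

Local Notation e := (expo a b c).
Local Notation gam := (@monomial_point F a b c).
Local Notation C := (monomial_curve F a b c).
Local Notation pull := (@pull F a b c).
Local Notation pt := (@pt F a b c).

(** Forward, elements of the cube of the maximal ideal vanish to order three in the parameter.
    Backward, the cofactor of (X - t)^3, composed with [tau], supplies a regular coefficient. *)
Lemma osculating_plane_dvdp t w : t != 0 ->
  osculating_plane C (pt t) w <-> ('X - t%:P) ^+ 3 %| pull (linform (rep w)).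
Proof.
move=> nz_t; set W := pull _.
have hom u : homogeneous (linform u) := dhomog_homogeneous (dhomog_linform u).
have pt0 u : hval (linform u) (pt t) = 0 <-> (pull (linform u)).[t] = 0.
  exact: hval_pt.
split=> [[_] | dvdW].
  (* The denominator is taken to be X_0, constantly 1 along gamma, so that only the equation of the
     plane remains. *)
  have X0 s : (pull (linform 'e_o0)).[s] = 1.
    rewrite pullE meval_linform sum_ord4 !mxE /= expr0.
    by rewrite mulr1 !mul0r !addr0.
  have /[swap]/[apply] : hval (linform 'e_o0) (pt t) != 0.
    by apply/eqP => /pt0; rewrite X0 => /eqP; rewrite oner_eq0.
  case/order_geq_max_ideal_pow => D Dt [E WE].
  have {}WE : W * D = ('X - t%:P) ^+ 3 * E.
    apply/eqP; rewrite -subr_eq0; apply/eqP; apply: (@poly_eq0_cofinite _ D).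
      by apply: contraNneq Dt => ->; rewrite horner0.
    move=> s /WE; rewrite (hval_ratio (dhomog_linform _) (dhomog_linform _) (val_pt _)).
    by rewrite -!pullE X0 divr1 -/W hornerD hornerN !hornerM => ->; rewrite subrr.
  have : ('X - t%:P) ^+ 3 %| W * D by rewrite WE dvdp_mulr.
  by rewrite Gauss_dvdpl // coprimep_expl // coprimep_sym coprimep_XsubC.
split; first by apply/pt0; case/dvdp_XsubC_cubeP: dvdW.
move=> l /eqP/pt0 /eqP lt; have /dvdpP[q qE] := dvdW.
have [al [be [ch bez]]] := bezout_nat ha (ltn_trans ha hab) hgcd.
pose T := tau (F := F) al be ch.
have Tpt s : s != 0 -> T (pt s) = s by apply: tau_pt.
(* One summand: (q / l)(tau) times the cube of tau - t, with [l] restricted to gamma. *)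
exists 1%N, (fun _ y => q.[T y] / (pull (linform l)).[T y]), (fun _ _ y => T y - t).
split=> [i | i j |].
- by apply: (regular_at_pt ha hab hbc bez nz_t lt) => s /Tpt->.
- split; last by rewrite Tpt ?subrr.
  apply: (regular_at_pt (P := 'X - t%:P) (Q := 1) ha hab hbc bez nz_t).
    by rewrite hornerC oner_eq0.
  by move=> s /Tpt->; rewrite !hornerE divr1.
apply: (near_torus ha hab hbc bez nz_t) => s nz_s.
rewrite (hval_ratio (dhomog_linform _) (dhomog_linform l) (val_pt _)) -!pullE.
rewrite big_ord1 prodr_const card_ord Tpt // -/W qE.
by rewrite hornerM horner_exp hornerXsubC mulrAC.
Qed.

Local Notation A := (a%:R : F).
Local Notation B := (b%:R : F).
Local Notation G := (c%:R : F).

(* The signed minors of the 3 x 4 matrix (e_i^k), k < 3 *)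
Definition vdm_minors : 'rV[F]_4 := \row_i nth 0
  [:: (B - A) * (G - A) * (G - B); - (B * G * (G - B));
      A * G * (G - A); - (A * B * (B - A))] i.

Lemma vdm_minors_neq0 i : vdm_minors 0 i != 0.
Proof.
have hb := ltn_trans ha hab; have hc := ltn_trans hb hbc.
have hac := ltn_trans hab hbc.
by elim/forall_ord4: i; rewrite mxE /= ?oppr_eq0 !mulf_neq0 ?natr_neq0 ?natrB_neq0.
Qed.

Definition vdm_moment k v : F := \sum_i v 0 i * (e i)%:R ^+ k.

Lemma vdm_kernel v : vdm_moment 0 v = 0 -> vdm_moment 1 v = 0 ->
  vdm_moment 2 v = 0 -> v = (v 0 o3 / vdm_minors 0 o3) *: vdm_minors.
Proof.
rewrite /vdm_moment !sum_ord4 /expo /= => S0 S1 S2.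
suff E i : v 0 i * vdm_minors 0 o3 = v 0 o3 * vdm_minors 0 i.
  apply/rowP => i; rewrite mxE mulrAC -E mulfK //; exact: vdm_minors_neq0.
have R (x y z r0 r1 r2 : F) : r0 = 0 -> r1 = 0 -> r2 = 0 ->
    x * r0 + y * r1 + z * r2 = 0.
  by move=> -> -> ->; rewrite !mulr0 !addr0.
apply/eqP; rewrite -subr_eq0; apply/eqP.
(* For i < 3 the coefficients are those of a multiple of the quadratic polynomial vanishing at the
   two exponents other than e_i and e_3; this eliminates the two other coordinates. *)
elim/forall_ord4: i; rewrite !mxE /=.
- by rewrite -(R (- (B - A) * A * B) ((B - A) * (A + B)) (- (B - A)) _ _ _ S0 S1 S2); ring.
- by rewrite -(R 0 (- B * B) B _ _ _ S0 S1 S2); ring.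
- by rewrite -(R 0 (A * A) (- A) _ _ _ S0 S1 S2); ring.
- by ring.
Qed.

Lemma vdm_minors_moment k r : (k < 3)%N -> vdm_moment k (r *: vdm_minors) = 0.
Proof.
by case: k => [|[|[|//]]] _; rewrite /vdm_moment sum_ord4 !mxE /expo /=; ring.
Qed.

Lemma pull_linform u : pull (linform u) = \sum_i u 0 i *: 'X^(e i).
Proof. exact: subst_linform. Qed.

(* The Euler operator t d/dt acts on t^n as multiplication by n *)
Lemma horner_monomial_deriv n t : t * ('X^n)^`().[t] = n%:R * t ^+ n.
Proof.
rewrite derivXn hornerMn hornerXn; case: n => [|n]; first by rewrite mulr0n mulr0 mul0r.
by rewrite mulrnAr -exprS mulr_natl.
Qed.

Lemma horner_monomial_deriv2 n t :
  t ^+ 2 * ('X^n)^`()^`().[t] = n%:R * (n%:R - 1) * t ^+ n.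
Proof.
rewrite derivXn derivMn hornerMn mulrnAr expr2 -mulrA horner_monomial_deriv.
case: n => [|n]; first by rewrite mulr0n !mul0r.
by rewrite -mulr_natl [t ^+ n.+1]exprS [n.+1%:R]mulrS /=; ring.
Qed.

(** The Euler operator turns the vanishing of the value and of two derivatives at [t] into that of
    the moments 0, 1, 2 of (u_i t^e_i), hence into proportionality to the Vandermonde minors. *)
Lemma dvdp_pull_linform t u : t != 0 ->
  ('X - t%:P) ^+ 3 %| pull (linform u) <->
  exists r, u = r *: (gam t^-1 *m diag_mx vdm_minors).
Proof.
move=> nz_t; pose v : 'rV[F]_4 := \row_i (u 0 i * t ^+ e i).
have P0 : (pull (linform u)).[t] = vdm_moment 0 v.
  rewrite pull_linform horner_sum; apply: eq_bigr => i _.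
  by rewrite hornerZ hornerXn mxE mulr1.
have P1 : t * (pull (linform u))^`().[t] = vdm_moment 1 v.
  rewrite pull_linform raddf_sum /= horner_sum mulr_sumr; apply: eq_bigr => i _.
  by rewrite derivZ hornerZ mulrCA horner_monomial_deriv mxE; ring.
have P2 : t ^+ 2 * (pull (linform u))^`()^`().[t] =
    vdm_moment 2 v - vdm_moment 1 v.
  rewrite pull_linform !raddf_sum /= horner_sum mulr_sumr -big_split /=.
  apply: eq_bigr => i _.
  by rewrite !derivZ hornerZ mulrCA horner_monomial_deriv2 mxE; ring.
(* Dividing the i-th coordinate by t^e_i introduces gamma(1/t). *)
have uE r : v = r *: vdm_minors <-> u = r *: (gam t^-1 *m diag_mx vdm_minors).
  rewrite mul_mx_diag; split=> [/rowP vE | uE]; apply/rowP => i.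
    have := vE i; rewrite !mxE -/(e i) exprVn => uE.
    apply: (mulIf (expf_neq0 (e i) nz_t)); rewrite uE; field.
    by rewrite expf_neq0.
  by rewrite [LHS]mxE uE !mxE -/(e i) exprVn; field; rewrite expf_neq0.
split=> [/dvdp_XsubC_cubeP[D0 D1 D2] | [r /uE vE]].
  rewrite D0 in P0; rewrite D1 mulr0 in P1; rewrite D2 mulr0 -P1 subr0 in P2.
  by exists (v 0 o3 / vdm_minors 0 o3); apply/uE/vdm_kernel.
rewrite vE !vdm_minors_moment // in P0 P1 P2.
apply/dvdp_XsubC_cubeP; split; first exact: P0.
  by apply/eqP; move/eqP: P1; rewrite mulf_eq0 (negPf nz_t).
by apply/eqP; move/eqP: P2; rewrite subr0 mulf_eq0 expf_eq0 (negPf nz_t).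
Qed.

Lemma dual_vector_neq0 t : gam t *m diag_mx vdm_minors != 0.
Proof.
apply/eqP => /rowP/(_ o0); rewrite mul_mx_diag !mxE expr0 mul1r.
by apply/eqP; have := vdm_minors_neq0 o0; rewrite mxE.
Qed.

Lemma osculating_planeP t w : t != 0 -> osculating_plane C (pt t) w <->
  val w = <[gam t^-1 *m diag_mx vdm_minors]>%VS.
Proof.
move=> nz_t; rewrite osculating_plane_dvdp // dvdp_pull_linform //.
split=> [[r wE] | /rep_line[r nz_r ->]]; last by exists r.
rewrite val_rep wE vline_scale //; apply: contraNneq (rep_neq0 w) => r0.
by rewrite wE r0 scale0r.
Qed.

Definition dual_map : 'End('rV[F]_4) := linfun (mulmxr (diag_mx vdm_minors)).

Lemma dual_map_line v :
  (dual_map @: <[v]>)%VS = <[v *m diag_mx vdm_minors]>%VS.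
Proof. by rewrite limg_line lfunE. Qed.

Definition inv_minors : 'rV[F]_4 := \row_i (vdm_minors 0 i)^-1.

Lemma mul_minors_inv v : v *m diag_mx vdm_minors *m diag_mx inv_minors = v.
Proof.
apply/rowP => i; rewrite !mul_mx_diag !mxE mulfK //.
by have := vdm_minors_neq0 i; rewrite mxE.
Qed.

Lemma mul_inv_minors v : v *m diag_mx inv_minors *m diag_mx vdm_minors = v.
Proof.
apply/rowP => i; rewrite !mul_mx_diag !mxE divfK //.
by have := vdm_minors_neq0 i; rewrite mxE.
Qed.

Lemma lker_dual_map : lker dual_map == 0%VS.
Proof.
apply/lker0P => u v; rewrite !lfunE /= => uvE.
by rewrite -[u]mul_minors_inv uvE mul_minors_inv.
Qed.

Lemma dense_open_torus U : dense_open_in C U ->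
  exists2 N : {poly F}, N != 0 & forall s, N.[s] != 0 -> U (pt s).
Proof.
move=> [oU dU]; have [y Uy] : exists y, U y.
  (* If [U] were empty, the constant form 1 would vanish on it and, by density, at [pt 0]. *)
  apply: contrapT => noU; have /zclosureP := dU _ (curve_pt 0).
  move=> /(_ 1 (dhomog_homogeneous (dhomog1 _ _))) h.
  have /eqP : hval 1 (pt 0) = 0 by apply: h => y Uy; case: noU; exists y.
  by rewrite /hval rmorph1 oner_eq0.
have [p [hp py0 pU]] := zopen_pull oU Uy; exists (pull p) => //.
apply: contra_not_neq py0 => p0; move: Uy; case: oU => Z _ -> [/curveP Cy _].
exact: Cy.
Qed.

(* The dual curve is also parametrized by monomials in t, instead of t^-1 *)
Lemma dual_arc k p t : p \is k.-homog -> t != 0 ->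
  (subst (fun i => vdm_minors 0 i *: 'X^(c - e i)) p).[t] =
  t ^+ c ^+ k * (mscale vdm_minors p).@[gam t^-1 0].
Proof.
move=> hp nz_t; rewrite substE meval_mscale -(homogZ _ _ hp).
apply: meval_eq => i; rewrite hornerZ hornerXn mul_mx_diag [RHS]mxE [in RHS]mxE gamE.
have le_ic : (e i <= c)%N by rewrite (_ : c = e o3) // expo_mono // -ltnS.
rewrite mulrA mulrC; congr (_ * _).
have -> : t ^+ c = t ^+ (c - e i) * t ^+ e i by rewrite -exprD subnK.
by rewrite exprVn mulfK // expf_neq0.
Qed.

Lemma curve_osculating_self_dual : osculating_self_dual C.
Proof.
exists [set w | exists2 x, C x & val w = (dual_map @: val x)%VS]%classic; last first.
  by exists dual_map => //; apply: lker_dual_map.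
have [al [be [ch bez]]] := bezout_nat ha (ltn_trans ha hab) hgcd.
have torusP := torus_partP ha hab hbc bez.
exists (torus_part a b c); split.
- split; first exact: zopen_torus_part.
  (* Density of the torus part: a polynomial vanishing at all t != 0 is zero. *)
  move=> x /curveP Cx; apply/zclosureP => p hp p0; apply: Cx => //.
  apply: (@poly_eq0_cofinite _ 'X); first by rewrite polyX_eq0.
  by move=> t; rewrite hornerX => nz_t; apply/hval_pt/p0/torusP; [|exists t].
- move=> x /torusP[t nz_t ->]; exists (line (dual_vector_neq0 t^-1)).
  split; first by apply/osculating_planeP.
  by move=> w /(osculating_planeP _ nz_t) wE; apply: val_inj; rewrite wE.
move=> U dU sUT; have [N nz_N NU] := dense_open_torus dU.
apply/seteqP; split=> w.
  move=> [x /curveP Cx wE]; apply/zclosureP => p hp p0.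
  apply/(hval_eq0P hp (v := rep x *m diag_mx vdm_minors)).
    by rewrite wE val_rep dual_map_line.
  rewrite -meval_mscale; apply: Cx; first exact: homog_mscale.
  (* Up to scaling, d gamma(1/t) is the polynomial arc d_i t^(c - e_i). A form vanishing on the
     osculating planes over [U] vanishes on this arc for almost all t, hence identically. *)
  have [k hk] := hp; set q := subst (fun i => vdm_minors 0 i *: 'X^(c - e i)) p.
  have q0 : q = 0.
    apply: (@poly_eq0_cofinite _ ('X * N)); first by rewrite mulf_neq0 ?polyX_eq0.
    move=> t; rewrite hornerM hornerX mulf_eq0 negb_or => /andP[nz_t Nt].
    rewrite (dual_arc hk nz_t) meval_mscale.
    suff /(hval_eq0P hp)-> : hval p (line (dual_vector_neq0 t^-1)) = 0.
    - by rewrite mulr0.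
    - by [].
    by apply: p0; exists (pt t); [apply: NU | apply/osculating_planeP].
  apply: (@poly_eq0_cofinite _ 'X) => [|t]; first by rewrite polyX_eq0.
  rewrite hornerX pullE -{2}[t]invrK => nz_t.
  have := dual_arc hk (invr_neq0 nz_t); rewrite -/q q0 horner0 => /esym/eqP.
  by rewrite mulf_eq0 !expf_eq0 invr_eq0 (negPf nz_t) !andbF => /eqP.
(* Conversely, the inverse diagonal matrix carries [w] back to the curve: a form vanishing on [C],
   composed with it, vanishes on the osculating planes. *)
move=> /zclosureP clw; have nz_v : rep w *m diag_mx inv_minors != 0.
  apply: contraNneq (rep_neq0 w) => v0.
  by rewrite -[rep w]mul_inv_minors v0 mul0mx.
exists (line nz_v); last by rewrite dual_map_line mul_inv_minors -val_rep.
apply/curveP => p hp p0; apply/(hval_eq0P hp (v := _)); first reflexivity.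
rewrite -meval_mscale; apply: clw; first exact: homog_mscale.
move=> w' [x /sUT/torusP[t nz_t ->]] /(osculating_planeP _ nz_t) w'E.
apply/(hval_eq0P (homog_mscale _ hp) w'E).
by rewrite meval_mscale mul_minors_inv -pullE p0 horner0.
Qed.

End SelfDuality.

(** * Tangent cones through derivatives along arcs, and contact hyperplanes *)

Lemma horner_deriv_subst (R : comNzRingType) n (f : 'I_n -> {poly R})
    (p : {mpoly R[n]}) t :
  (subst f p)^`().[t] =
  \sum_i (f i)^`().[t] * (p^`M(i)).@[fun i => (f i).[t]].
Proof.
by rewrite deriv_subst horner_sum; apply: eq_bigr => i _; rewrite hornerM substE.
Qed.

(** This turns the equations of [tangent_cone] into derivatives along the line v + s u, computed by
    the product and power rules. *)
Lemma sum_mderiv_line (R : comNzRingType) n (p : {mpoly R[n]}) (v u : 'rV[R]_n) :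
  \sum_i u 0 i * (p^`M(i)).@[v 0] =
  (subst (fun i => (v 0 i)%:P + u 0 i *: 'X) p)^`().[0].
Proof.
rewrite horner_deriv_subst; apply: eq_bigr => i _; rewrite !derivE !hornerE.
by congr (_ * _); apply: meval_eq => j; rewrite !hornerE.
Qed.

Section ContactStructure.
Variables (F : numFieldType) (B : {skew_symmetric 'rV[F]_4}).
Implicit Types (u v : 'rV[F]_4) (y : proj F 3).

Lemma skewC u v : B u v = - B v u.
Proof. by rewrite hermC /= expr1 mulN1r. Qed.

Lemma skew_diag u : B u u = 0.
Proof.
have /eqP := skewC u u; rewrite -addr_eq0 -mulr2n.
by rewrite mulrn_eq0 => /eqP.
Qed.

Lemma bilinear_coords u v :
  B u v = \sum_i \sum_j u 0 i * v 0 j * B 'e_i 'e_j.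
Proof.
rewrite {1}[u]row_sum_delta linear_sumlz; apply: eq_bigr => i _.
rewrite linearZl_LR /= {1}[v]row_sum_delta linear_sum mulr_sumr.
by apply: eq_bigr => j _; rewrite linearZ /= mulrA.
Qed.

(** The polar plane is cut out by the linear form B(y, .), which is thus a test equation for [u].
    Conversely, if it kills [u], the line y + s u lies in the polar plane, and forms vanishing there
    vanish along the line. *)
Lemma contact_hyperplaneP y u : contact_hyperplane B y u <-> B (rep y) u = 0.
Proof.
have polarP z : polar_plane B y z <-> B (rep y) (rep z) = 0.
  split=> [|yz u1 u2]; first by apply; rewrite memv_pick.
  rewrite !val_rep => /vlineP[k1 ->] /vlineP[k2 ->].
  by rewrite linearZl_LR linearZ /= yz !mulr0.
pose w : 'rV[F]_4 := \row_i B (rep y) 'e_i.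
have wE v : B (rep y) v = \sum_i w 0 i * v 0 i.
  rewrite {1}[v]row_sum_delta linear_sum; apply: eq_bigr => i _.
  by rewrite linearZ /= mxE mulrC.
split=> [cu | yu p hp p0].
  have := cu _ (dhomog_homogeneous (dhomog_linform w)).
  rewrite sum_mderiv_line subst_linform raddf_sum /= horner_sum => wu.
  rewrite wE -[RHS]wu; last by move=> z /polarP; rewrite wE /hval meval_linform.
  by apply: eq_bigr => i _; rewrite !derivE !hornerE /= mulr1.
rewrite sum_mderiv_line; set q := subst _ p.
have [k nz_k] : exists k, rep y 0 k != 0 by apply/rV0Pn/rep_neq0.
suff -> : q = 0 by rewrite deriv0 horner0.
(* The k-th coordinate of y + s u is a nonzero polynomial in s, so the vector is nonzero for almost
   all s. *)
apply: (@poly_eq0_cofinite _ ((rep y 0 k)%:P + u 0 k *: 'X)).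
  apply: contraNneq nz_k => /(congr1 (fun r => r.[0])).
  by rewrite !hornerE => ->.
move=> s nz_s; rewrite substE.
have nz_v : rep y + s *: u != 0.
  apply: contraNneq nz_s => /rowP/(_ k); rewrite !mxE !hornerE /= => <-.
  by rewrite mulrC.
have : hval p (line nz_v) = 0.
  apply/p0/polarP; have [r _ ->] := @rep_line _ _ (line nz_v) _ erefl.
  by rewrite linearZ linearD linearZ /= yu skew_diag mulr0 addr0 mulr0.
move=> /(hval_line nz_v hp) <-; apply: meval_eq => i.
by rewrite !mxE !hornerE /= mulrC.
Qed.

End ContactStructure.

(** * Tangent lines of the curve and the Legendrian condition *)

Section Legendrian.
Variables (F : numFieldType) (a b c : nat).
Hypotheses (ha : (0 < a)%N) (hab : (a < b)%N) (hbc : (b < c)%N).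
Hypothesis hgcd : gcdn a (gcdn b c) = 1%N.
Implicit Types (t s : F) (x y : proj F 3) (p q : {mpoly F[4]}) (u v : 'rV[F]_4).

Local Notation e := (expo a b c).
Local Notation gam := (@monomial_point F a b c).
Local Notation C := (monomial_curve F a b c).
Local Notation pull := (@pull F a b c).
Local Notation pt := (@pt F a b c).

Lemma deriv_exp_line (r z : F) n : r != 0 ->
  (((r%:P + z *: 'X) ^+ n)^`()).[0] = n%:R * (z / r) * r ^+ n.
Proof.
move=> nz_r; rewrite deriv_exp hornerMn hornerM horner_exp !derivE !hornerE.
rewrite /=; case: n => [|n]; first by rewrite !mulr0n !mul0r.
by rewrite -mulr_natl /= exprS; field.
Qed.

Lemma curve_hval_pull p y : homogeneous p -> pull p = 0 -> C y -> hval p y = 0.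
Proof. by move=> hp p0 /curveP; apply. Qed.

(** Logarithmic differentiation of the toric binomial: the common value of its two monomials is
    nonzero on the torus and cancels. *)
Lemma tangent_binomial y u (i j : 'I_4) : (i <= j)%N ->
  C y -> (forall k, rep y 0 k != 0) -> tangent_cone C y u ->
  (e j)%:R * (u 0 i / rep y 0 i) = (e i)%:R * (u 0 j / rep y 0 j) +
    (e j - e i)%:R * (u 0 o0 / rep y 0 o0).
Proof.
move=> le_ij Cy nz_y /(_ (toric_binomial F a b c i j)).
have hom := dhomog_homogeneous (homog_toric_binomial F ha hab hbc le_ij).
move=> /(_ hom) /(_ (fun z => curve_hval_pull hom (pull_toric_binomial F a b c i j))).
rewrite sum_mderiv_line /toric_binomial substB substM !substXn !substX.
rewrite derivB derivM hornerD hornerN hornerD !hornerM !deriv_exp_line //.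
rewrite !horner_exp !hornerE /=.
have := curve_binomial ha hab hbc le_ij Cy => bin.
move/eqP; rewrite subr_eq0 bin => /eqP E.
have nzK : rep y 0 j ^+ e i * rep y 0 o0 ^+ (e j - e i) != 0.
  by rewrite mulf_neq0 ?expf_neq0.
by apply: (mulIf nzK); rewrite E; ring.
Qed.

Lemma tangent_torusP y u : C y -> (forall i, rep y 0 i != 0) ->
  tangent_cone C y u <->
  exists al be, forall i, u 0 i = rep y 0 i * (al + be * (e i)%:R).
Proof.
move=> Cy nz_y; split=> [Tu | [al [be uE]] p hp p0].
  pose r i := u 0 i / rep y 0 i; have nz_a := natr_neq0 F ha.
  exists (r o0), ((r o1 - r o0) / a%:R) => i.
  rewrite -[u 0 i](divfK (nz_y i)) -/(r i) mulrC; congr (_ * _).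
  have E (j : 'I_4) : (1 <= j)%N -> r j = r o0 + (r o1 - r o0) / a%:R * (e j)%:R.
    move=> le_1j; have := @tangent_binomial y u o1 j le_1j Cy nz_y Tu.
    have le_aj : (a <= e j)%N := expo_mono ha hab hbc (le_1j : (o1 <= j)%N).
    rewrite -!/(r _) natrB // [e o1]/= => rE.
    by apply: (mulfI nz_a); field: rE.
  elim/forall_ord4: i; try exact: E.
  by rewrite [e o0]/= mulr0 addr0.
(* An arc in the cone over the curve: the vector is rescaled by 1 + al s and the parameter t by 1 +
   be s. At s = 0 its value is [rep y] and its velocity is [u]. *)
pose f i : {poly F} := rep y 0 i *: ((1 + al *: 'X) * (1 + be *: 'X) ^+ e i).
have f0 i : (f i).[0] = rep y 0 i.
  by rewrite !hornerE /= expr1n !mulr1.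
have f1 i : (f i)^`().[0] = u 0 i.
  rewrite uE derivZ derivM deriv_exp !derivE !(hornerE, hornerMn) /=.
  by rewrite !expr1n -mulr_natr; ring.
have ppt s : (pull p).[s] = 0 by apply/(hval_pt hp)/p0; exact: curve_pt.
have [al' [be' [ch' bez]]] := bezout_nat ha (ltn_trans ha hab) hgcd.
have -> : \sum_i u 0 i * (p^`M(i)).@[rep y 0] = (subst f p)^`().[0].
  rewrite horner_deriv_subst; apply: eq_bigr => i _; rewrite f1.
  by congr (_ * _); apply: meval_eq => j; rewrite f0.
suff -> : subst f p = 0 by rewrite deriv0 horner0.
apply: poly_eq0 => s; rewrite substE.
have [d hd] := hp; have [t _ yE] := torus_pt ha hab hbc bez Cy nz_y.
have [k _ repE] := rep_line (erefl : val (pt t) = <[gam t]>%VS).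
pose r := k * (1 + al * s); pose t' := t * (1 + be * s).
rewrite -[RHS](mulr0 (r ^+ d)) -(ppt t') pullE -(homogZ _ _ hd).
apply: meval_eq => i; rewrite !mxE /f yE repE !hornerE /= !mxE.
by rewrite exprMn -/(e i) /r; ring.
Qed.

(** At v = gamma(t) this is the Euler derivative t gamma'(t). *)
Definition logderiv v : 'rV[F]_4 := \row_i (v 0 i * (e i)%:R).

Lemma smooth_torus y : C y -> (forall i, rep y 0 i != 0) -> smooth_point C y.
Proof.
move=> Cy nz_y; split=> //; set v := rep y; set v' := logderiv v.
exists <<[:: v; v']>>%VS.
  apply/seteqP; split=> u.
    move=> /(tangent_torusP _ Cy nz_y) [al [be uE]].
    rewrite /= span_cons span_seq1; apply/memv_addP.
    exists (al *: v); first by rewrite memvZ ?memv_line.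
    exists (be *: v'); first by rewrite memvZ ?memv_line.
    by apply/rowP => i; rewrite uE !mxE; ring.
  rewrite /= span_cons span_seq1 => /memv_addP[_ /vlineP[al ->] [_ /vlineP[be ->] ->]].
  apply/(tangent_torusP _ Cy nz_y); exists al, be => i.
  by rewrite !mxE; ring.
have nz_v' : v' != 0.
  apply/eqP => /rowP/(_ o1); rewrite !mxE => /eqP; apply/negP.
  by rewrite mulf_neq0 // natr_neq0.
suff : free [:: v; v'] by rewrite /free => /eqP.
(* Coordinate 0 of [v'] is zero because e_0 = 0, while that of [v] is not. *)
rewrite free_cons seq1_free nz_v' andbT span_seq1; apply/vlineP => -[k /rowP/(_ o0)].
by rewrite !mxE /= !mulr0; apply/eqP.
Qed.

Lemma legendrian_gam (B : {skew_symmetric 'rV[F]_4}) t :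
  legendrian B C -> t != 0 -> B (gam t) (logderiv (gam t)) = 0.
Proof.
move=> legB nz_t; have [k nz_k repE] := rep_line (erefl : val (pt t) = <[gam t]>%VS).
have nz_y i : rep (pt t) 0 i != 0 by rewrite repE !mxE mulf_neq0 ?expf_neq0.
have : contact_hyperplane B (pt t) (logderiv (rep (pt t))).
  apply: (legB _ (smooth_torus (curve_pt t) nz_y)).
  apply/tangent_torusP => //; first exact: curve_pt.
  by exists 0, 1 => i; rewrite mxE; ring.
move=> /contact_hyperplaneP.
have -> : logderiv (rep (pt t)) = k *: logderiv (gam t).
  by apply/rowP => i; rewrite repE !mxE; ring.
rewrite repE linearZl_LR linearZ /= => /eqP.
by rewrite !mulf_eq0 (negPf nz_k) => /eqP.
Qed.

Lemma legendrian_symmetric (B : {skew_symmetric 'rV[F]_4}) :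
  nondegenerate B -> legendrian B C -> (a + b)%N = c.
Proof.
move=> ndB legB; apply/eqP; apply: contraTT ndB => /eqP ne_abc.
pose bb i j := B 'e_i 'e_j.
(* For i < j, [ns] lists the e_i + e_j and [cs], in the same order, the coefficients B_ij (e_j -
   e_i). *)
pose ns := [:: a; b; c; a + b; a + c; b + c]%N.
pose cs : seq F := [:: bb o0 o1 * a%:R; bb o0 o2 * b%:R; bb o0 o3 * c%:R;
  bb o1 o2 * (b%:R - a%:R); bb o1 o3 * (c%:R - a%:R); bb o2 o3 * (c%:R - b%:R)].
have P0 : \sum_(i < 6) cs`_i *: 'X^(nth 0%N ns i) = 0 :> {poly F}.
  apply: (@poly_eq0_cofinite _ 'X); first by rewrite polyX_eq0.
  move=> t; rewrite hornerX => nz_t; rewrite -[RHS](legendrian_gam legB nz_t).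
  rewrite bilinear_coords !sum_ord4 horner_sum !big_ord_recl big_ord0 /=.
  rewrite !hornerZ !hornerXn !mxE /= !skew_diag.
  rewrite (skewC _ 'e_o1 'e_o0) (skewC _ 'e_o2 'e_o0) (skewC _ 'e_o3 'e_o0).
  rewrite (skewC _ 'e_o2 'e_o1) (skewC _ 'e_o3 'e_o1) (skewC _ 'e_o3 'e_o2).
  by rewrite !exprD /bb /expo /=; ring.
(* Given 0 < a < b < c, the only possible coincidence is a + b = c. *)
have nsU : uniq ns by rewrite /= !inE; lia.
have ns_inj : injective (fun i : 'I_6 => nth 0%N ns i).
  by move=> i j /eqP; rewrite nth_uniq // => /eqP/val_inj.
have cs0 := sum_monomials_eq0 ns_inj P0.
have hb := ltn_trans ha hab; have hc := ltn_trans hb hbc.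
have cancel (r : F) n : r * n%:R = 0 -> (0 < n)%N -> r = 0.
  by move=> /eqP + n0; rewrite mulf_eq0 (negPf (natr_neq0 F n0)) orbF => /eqP.
(* The first three coefficients put e_0 in the radical of [B]. *)
have b0 j : B 'e_o0 'e_j = 0.
  elim/forall_ord4: j; first exact: skew_diag.
  - exact: cancel (cs0 (@Ordinal 6 0 isT)) ha.
  - exact: cancel (cs0 (@Ordinal 6 1 isT)) hb.
  - exact: cancel (cs0 (@Ordinal 6 2 isT)) hc.
apply/negP => /eqP ndB; have : 'e_o0 \in orthov B fullv.
  apply/mem_orthovP => v _; rewrite [v]row_sum_delta linear_sum big1 // => j _.
  by rewrite linearZ /= b0 mulr0.
rewrite ndB memv0 => /eqP/rowP/(_ o0); rewrite !mxE => /eqP.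
by rewrite oner_eq0.
Qed.

(** For c = a + b the exponents e_0 + e_3 and e_1 + e_2 coincide, and the coefficient of t^c is c
    B_03 + (b - a) B_12; the entries b - a and -c make it vanish. *)
Definition contact_mx : 'M[F]_4 :=
  (b%:R - a%:R) *: (delta_mx o0 o3 - delta_mx o3 o0) -
  c%:R *: (delta_mx o1 o2 - delta_mx o2 o1).

Lemma contact_mx_skew : contact_mx \is hermitianmx _ true (idfun : F -> F).
Proof.
apply/is_hermitianmxP; rewrite expr1 scaleN1r; apply/matrixP => i j.
by rewrite !mxE; elim/forall_ord4: i; elim/forall_ord4: j => /=; ring.
Qed.

Definition contact_form : {skew_symmetric 'rV[F]_4} :=
  form_of_matrix idfun (HermitianMx contact_mx_skew).

Lemma contact_formE u v : contact_form u v =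
  (b%:R - a%:R) * (u 0 o0 * v 0 o3 - u 0 o3 * v 0 o0) -
  c%:R * (u 0 o1 * v 0 o2 - u 0 o2 * v 0 o1).
Proof.
rewrite bilinear_coords.
under eq_bigr do under eq_bigr do rewrite [contact_form _ _]rV_formee.
by rewrite !sum_ord4 !mxE /=; ring.
Qed.

(** Pairing [u] with the basis vector of index 3 - i gives u_i up to sign and a nonzero factor b - a
    or c. *)
Lemma contact_form_nondegenerate : nondegenerate contact_form.
Proof.
have nz_c := natr_neq0 F (ltn_trans ha (ltn_trans hab hbc)).
have nz_ba := natrB_neq0 F hab.
rewrite /nondegenerate -subv0; apply/subvP => u /mem_orthovP u0.
have U j := u0 'e_j (memvf _); rewrite memv0; apply/eqP/rowP => i; rewrite [RHS]mxE.
have := U o3; have := U o2; have := U o1; have := U o0.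
rewrite !contact_formE !mxE /= => U0 U1 U2 U3.
elim/forall_ord4: i.
- by apply: (mulfI nz_ba); rewrite [RHS]mulr0 -[RHS]U3; ring.
- by apply: (mulfI nz_c); rewrite [RHS]mulr0 -[RHS]oppr0 -[in RHS]U2; ring.
- by apply: (mulfI nz_c); rewrite [RHS]mulr0 -[RHS]U1; ring.
- by apply: (mulfI nz_ba); rewrite [RHS]mulr0 -[RHS]oppr0 -[in RHS]U0; ring.
Qed.

Definition quadric : {mpoly F[4]} := 'X_o0 * 'X_o3 - 'X_o1 * 'X_o2.

Lemma homog_quadric : quadric \is 2.-homog.
Proof. by rewrite rpredB //; apply: (@dhomogM _ _ _ 1 _ 1); apply: dhomogX1. Qed.

Lemma pull_quadric : (a + b)%N = c -> pull quadric = 0.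
Proof.
move=> abc; rewrite /pull substB !substM !substX -!exprD /expo /= abc.
by rewrite add0n subrr.
Qed.

Lemma tangent_quadric y u : (a + b)%N = c -> tangent_cone C y u ->
  let v := rep y in
  u 0 o0 * v 0 o3 + v 0 o0 * u 0 o3 = u 0 o1 * v 0 o2 + v 0 o1 * u 0 o2.
Proof.
move=> abc Tu v; have hom := dhomog_homogeneous homog_quadric.
have := Tu _ hom (fun z => curve_hval_pull hom (pull_quadric abc)).
rewrite sum_mderiv_line substB !substM !substX !derivE !hornerE /= -/v.
move/eqP; rewrite subr_eq0 => /eqP.
by rewrite !mulr1.
Qed.

Lemma contact_form_legendrian : (a + b)%N = c -> legendrian contact_form C.
Proof.
move=> abc y [Cy _] u Tu; apply/contact_hyperplaneP; rewrite contact_formE.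
have quad := tangent_quadric abc Tu; rewrite /= in quad.
case: (curve_cases ha hab hbc Cy) => [nz_y | [nz0 v1 v2 v3] | [v0 v1 v2 nz3]].
- have [al [be uE]] := (tangent_torusP u Cy nz_y).1 Tu.
  have := curve_hval_pull (dhomog_homogeneous homog_quadric) (pull_quadric abc) Cy.
  rewrite /hval rmorphB !rmorphM /= !mevalXU => vq.
  (* The form equals (b - a) c be times the value of the quadric, which is zero on the curve. *)
  by rewrite !uE /expo /= -[RHS](mulr0 ((b%:R - a%:R) * c%:R * be)) -vq; ring.
(* At (1 : 0 : 0 : 0) the form reduces to (b - a) v_0 u_3, and the derivative of the quadric gives
   v_0 u_3 = 0; at (0 : 0 : 0 : 1) the same holds with indices 0 and 3 exchanged, up to sign. *)
- move: quad; rewrite v1 v2 v3 !mulr0 !mul0r add0r addr0 => /eqP.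
  by rewrite mulf_eq0 (negPf nz0) => /eqP ->; ring.
- move: quad; rewrite v0 v1 v2 !mulr0 !mul0r !addr0 => /eqP.
  by rewrite mulf_eq0 (negPf nz3) orbF => /eqP ->; ring.
Qed.

End Legendrian.

Theorem proposition5p1 (R : realType) (a b c : nat)
    (ha : (0 < a)%N) (hab : (a < b)%N) (hbc : (b < c)%N)
    (hgcd : gcdn a (gcdn b c) = 1%N) :
  osculating_self_dual (monomial_curve R[i] a b c) /\
  ((exists2 B : {skew_symmetric 'rV[R[i]]_4},
      nondegenerate B & legendrian B (monomial_curve R[i] a b c)) <->
   (0, a, b, c)%N = (0, c - b, c - a, c)%N).
Proof.
split; first exact: (@curve_osculating_self_dual R[i] a b c ha hab hbc hgcd).
have -> : (0, a, b, c)%N = (0, c - b, c - a, c)%N <-> (a + b)%N = c.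
  by split=> [[] |abc]; [lia | congr (_, _, _, _); lia].
split=> [[B ndB legB] | abc].
  exact: (@legendrian_symmetric R[i] a b c ha hab hbc hgcd B ndB legB).
exists (@contact_form R[i] a b c).
  exact: (@contact_form_nondegenerate R[i] a b c ha hab hbc).
exact: (@contact_form_legendrian R[i] a b c ha hab hbc hgcd abc).
Qed.
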